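(* Let $1<p<\infty$, let $b\in\mathbb{C}$, and let $T\in\mathbb{L}(\ell^2_p)$ be the operator given by the matrix $T=\begin{pmatrix}1 & b\\ 0 & -1\end{pmatrix}$. Then the numerical range $V(T)$ is a convex set.
   Context: $\ell^2_p$ denotes the complex vector space $\mathbb{C}^2$ with norm $\|x\|_p=(|x_1|^p+|x_2|^p)^{1/p}$, and $\mathbb{L}(\ell^2_p)$ is the space of (bounded) linear operators on it; operators are identified with $2\times 2$ complex matrices acting on column vectors in the standard basis. The unique semi-inner-product compatible with the norm is $[x,y]_p=\dfrac{\sum_{k} x_k\overline{y_k}|y_k|^{p-2}}{\|y\|_p^{p-2}}$ for $y\neq 0$ and $[x,0]_p=0$ (where $\overline{y_k}|y_k|^{p-2}$ is read as $0$ when $y_k=0$). The numerical range is $V(T)=\{[Tx,x]_p : \|x\|_p=1\}\subset\mathbb{C}$. *)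

(* Defs.v *)
From mathcomp Require Import all_boot all_order all_algebra.
From mathcomp Require Import complex.
From mathcomp Require Import classical_sets reals exp.

Set Implicit Arguments.
Unset Strict Implicit.
Unset Printing Implicit Defensive.

Import GRing.Theory Num.Theory.

Local Open Scope ring_scope.
Local Open Scope classical_set_scope.
Local Open Scope complex_scope.

Notation cmod := ComplexField.Normc.normc.

Definition lpnorm (R : realType) (p : R) (n : nat) (x : 'cV[R[i]]_n) : R :=
  (\sum_(k < n) cmod (x k 0) `^ p) `^ p^-1.

(* The summands with y k 0 = 0 vanish whatever the value of 0 `^ (p - 2),
   because of the factor (y k 0)^*. *)
Definition lpsip (R : realType) (p : R) (n : nat) (x y : 'cV[R[i]]_n) : R[i] :=
  if y == 0 then 0
  else (\sum_(k < n) x k 0 * (y k 0)^* * (cmod (y k 0) `^ (p - 2))%:C)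
       / (lpnorm p y `^ (p - 2))%:C.

Definition numerical_range (R : realType) (p : R) (n : nat)
    (T : 'M[R[i]]_n) : set R[i] :=
  [set lpsip p (T *m x) x | x in [set x : 'cV[R[i]]_n | lpnorm p x = 1]].

Definition mx2 (K : Type) (a b c d : K) : 'M[K]_2 :=
  \matrix_(i < 2, j < 2)
    if i == 0 then (if j == 0 then a else b) else (if j == 0 then c else d).

(* Main.v *)
(* Vectors of norm 1 with |x_1|^p = u have [T x, x] = 2u - 1 + b x_2 w with
   |w| = u^(1 - 1/p), and the phase of x_2 is free: V(T) is the union over
   u in [0, 1] of the circles of centre 2u - 1 and radius |b| g(u), where
   g(u) = u^(1 - 1/p) (1 - u)^(1/p).  Since g is continuous and g(0) = g(1) = 0,
   each point of the disc bounded by one of these circles lies on one of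
   them (intermediate values), so V(T) is also the union of the discs; this
   union is convex because g is concave, by Hoelder's inequality. *)
Require Import Defs.
From mathcomp Require Import all_boot all_order all_algebra.
From mathcomp Require Import complex.
From mathcomp Require Import classical_sets reals exp convex.
From mathcomp Require Import interval_inference topology normedtype derive hoelder.
From mathcomp Require Import ring lra.

Set Implicit Arguments.
Unset Strict Implicit.
Unset Printing Implicit Defensive.

Import Order.TTheory GRing.Theory Num.Theory.
Import numFieldNormedType.Exports.
Import ComplexField.Normc.

Local Open Scope ring_scope.
Local Open Scope classical_set_scope.
Local Open Scope complex_scope.

Section WeightedGeometricMean.
Context {R : realType}.
Implicit Types a t u v x y : R.

(** The radius function of the circles is g(u) = [wgmean a u (1 - u)] with a = 1/p. Freeing the two
    arguments makes it homogeneous of degree 1, so that concavity reduces to superadditivity. *)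
Definition wgmean a x y : R := x `^ (1 - a) * y `^ a.

Lemma wgmean_ge0 a x y : 0 <= wgmean a x y.
Proof. by rewrite mulr_ge0 ?powR_ge0. Qed.

Lemma wgmean0l a y : a < 1 -> wgmean a 0 y = 0.
Proof. by move=> a1; rewrite /wgmean powR0 ?mul0r// subr_eq0 gt_eqF. Qed.

Lemma wgmean0r a x : 0 < a -> wgmean a x 0 = 0.
Proof. by move=> a0; rewrite /wgmean (powR0 (lt0r_neq0 a0)) mulr0. Qed.

Lemma wgmeanZ a t x y : 0 <= t -> 0 <= x -> 0 <= y ->
  wgmean a (t * x) (t * y) = t * wgmean a x y.
Proof.
(* The two powers of t merge even when t = 0, because their exponents add up to 1, which is
   nonzero. *)
move=> t0 x0 y0; rewrite /wgmean !powRM// mulrACA -powRD ?subrK ?powRr1//.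
by rewrite oner_eq0.
Qed.

(** Hoelder's inequality for two terms, with conjugate exponents 1/(1 - a) and 1/a; raising the
    entries to these exponents gives back the x's and y's. *)
Lemma wgmean_superadditive a x1 y1 x2 y2 : 0 < a < 1 ->
  0 <= x1 -> 0 <= y1 -> 0 <= x2 -> 0 <= y2 ->
  wgmean a x1 y1 + wgmean a x2 y2 <= wgmean a (x1 + x2) (y1 + y2).
Proof.
move=> /andP[a0 a1] x10 y10 x20 y20.
have b0 : 0 < 1 - a by rewrite subr_gt0.
have := @hoelder2 R (x1 `^ (1 - a)) (x2 `^ (1 - a)) (y1 `^ a) (y2 `^ a)
  (1 - a)^-1 a^-1.
rewrite !powR_ge0 !invr_gt0 !invrK -!powRrM !divff ?gt_eqF// !powRr1//.
by apply => //; rewrite subrK.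
Qed.

Lemma wgmean_concave a t u v : 0 < a < 1 -> 0 <= t <= 1 ->
  0 <= u <= 1 -> 0 <= v <= 1 ->
  t * wgmean a u (1 - u) + (1 - t) * wgmean a v (1 - v) <=
  wgmean a (t * u + (1 - t) * v) (1 - (t * u + (1 - t) * v)).
Proof.
move=> a01 /andP[t0 t1] /andP[u0 u1] /andP[v0 v1].
rewrite -!wgmeanZ ?subr_ge0//.
have -> : 1 - (t * u + (1 - t) * v) = t * (1 - u) + (1 - t) * (1 - v) by ring.
by apply: wgmean_superadditive => //; rewrite mulr_ge0 ?subr_ge0.
Qed.

Lemma continuous_powR a x : 0 < x -> {for x, continuous (@powR R ^~ a)}.
Proof.
move=> x0; apply: differentiable_continuous; apply/derivable1_diffP.
by apply: derivable_powR; rewrite in_itv/= x0.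
Qed.

Lemma continuous_onem_powR a x : x < 1 ->
  {for x, continuous (fun u => (1 - u) `^ a)}.
Proof.
move=> x1; apply: (@continuous_comp R R R (fun u => 1 - u) (@powR R ^~ a)).
  by apply: cvgB; [exact: cvg_cst|exact: cvg_id].
by apply: continuous_powR; rewrite subr_gt0.
Qed.

(** Keeping v < 1 holds 1 - u away from 0, so only u = 0 is delicate: there a limit from the right
    is taken, which is 0 since 1 - a > 0. *)
Lemma wgmean_within_continuous a v : a < 1 -> 0 < v < 1 ->
  {within `[0, v], continuous (fun u => wgmean a u (1 - u))}.
Proof.
move=> a1 /andP[v0 v1].
have cont x : 0 < x < 1 -> {for x, continuous (fun u => wgmean a u (1 - u))}.
  move=> /andP[x0 x1]; apply: cvgM; first exact: continuous_powR.
  exact: continuous_onem_powR.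
apply/continuous_within_itvP => //; split.
- by move=> x; rewrite in_itv/= => /andP[x0 xv]; apply: cont; rewrite x0 (lt_trans xv).
- apply: cvgM.
    by rewrite powR0 ?subr_eq0 ?gt_eqF//; apply: powR_cvg0; rewrite subr_gt0.
  apply: cvg_at_right_filter; exact: continuous_onem_powR.
- by apply: cvg_at_left_filter; apply: cont; rewrite v0.
Qed.

End WeightedGeometricMean.

Section NumericalRange.
Context {R : realType}.
Implicit Types (a p u B : R) (b z : R[i]).

Lemma normcE_sqr z : cmod z ^+ 2 = complex.Re z ^+ 2 + complex.Im z ^+ 2.
Proof. by case: z => x y /=; rewrite sqr_sqrtr// addr_ge0 ?sqr_ge0. Qed.

Lemma normc_ge0 z : 0 <= cmod z.
Proof. by case: z => x y /=; rewrite sqrtr_ge0. Qed.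

Lemma normc_real u : 0 <= u -> cmod u%:C = u.
Proof. by move=> u0 /=; rewrite expr0n/= addr0 sqrtr_sqr ger0_norm. Qed.

(** Provides the phase of x_2 that turns a point of a circle into the prescribed one. *)
Lemma normc_eq_phase w z : cmod w = cmod z -> exists2 e, cmod e = 1 & w = e * z.
Proof.
move=> wz; have [z0|z0] := eqVneq z 0.
  exists 1; first exact: normc1.
  by rewrite z0 mulr0; apply: eq0_normc; rewrite wz z0 normc0.
exists (w / z); last by rewrite divfK.
rewrite normcM normcV wz divff//.
by apply: contra_neq z0 => /eq0_normc.
Qed.

Lemma mul_conjc_powR p z : 0 < p ->
  z * z^* * (cmod z `^ (p - 2))%:C = (cmod z `^ p)%:C.
Proof.
move=> p0; have [->|z0] := eqVneq z 0.
  by rewrite !mul0r normc0 powR0// gt_eqF.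
have nz0 : cmod z != 0.
  by apply: contra_neq z0 => /eq0_normc.
have -> : z * z^* = (cmod z ^+ 2)%:C.
  by rewrite -normCK rmorphXn.
rewrite -rmorphM/= -powR_mulrn ?normc_ge0// -powRD; last by rewrite nz0 implybT.
by rewrite addrC subrK.
Qed.

(** The left side is |z|^(p - 1), rewritten in terms of u = |z|^p. At z = 0 both sides vanish, as 1
    - 1/p > 0. *)
Lemma normc_conjc_powR p z : 1 < p ->
  cmod (z^* * (cmod z `^ (p - 2))%:C) = (cmod z `^ p) `^ (1 - p^-1).
Proof.
move=> p1; have p0 : 0 < p by rewrite (lt_trans _ p1).
have [->|z0] := eqVneq z 0.
  rewrite rmorph0 mul0r normc0 !powR0// ?gt_eqF//.
  by rewrite subr_gt0 invf_lt1.
have nz0 : cmod z != 0.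
  by apply: contra_neq z0 => /eq0_normc.
rewrite normcM normc_real ?powR_ge0//.
have -> : cmod z^* = cmod z.
  exact: (congr1 (@complex.Re R) (norm_conjC z)).
rewrite -{1}(powRr1 (normc_ge0 z)) -powRD; last by rewrite nz0 implybT.
rewrite -powRrM; congr (_ `^ _); rewrite mulrBr mulr1 divff ?gt_eqF//; ring.
Qed.

Lemma lpnorm2_eq1 p (x : 'cV[R[i]]_2) : 0 < p ->
  lpnorm p x = 1 <-> cmod (x 0 0) `^ p + cmod (x 1 0) `^ p = 1.
Proof.
move=> p0; rewrite /lpnorm !big_ord_recl big_ord0 addr0.
have -> : lift ord0 ord0 = 1 :> 'I_2 by apply/val_inj.
split=> [|->]; last by rewrite powR1.
move=> /(congr1 (@powR R ^~ p)); rewrite -powRrM mulVf ?gt_eqF// powR1.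
by rewrite powRr1// addr_ge0 ?powR_ge0.
Qed.

Lemma lpsip_mx2 p b (x : 'cV[R[i]]_2) : 0 < p -> lpnorm p x = 1 ->
  lpsip p (mx2 1 b 0 (-1) *m x) x =
  (cmod (x 0 0) `^ p - cmod (x 1 0) `^ p)%:C +
  b * x 1 0 * ((x 0 0)^* * (cmod (x 0 0) `^ (p - 2))%:C).
Proof.
move=> p0 x1; rewrite /lpsip x1 powR1 divr1.
case: eqP x1 => [-> /(lpnorm2_eq1 _ p0)|_ _].
  rewrite !mxE normc0 powR0 ?gt_eqF// addr0.
  by move=> /esym/eqP; rewrite oner_eq0.
have l1 : lift ord0 ord0 = 1 :> 'I_2 by apply/val_inj.
rewrite !big_ord_recl big_ord0 addr0 !mxE !big_ord_recl !big_ord0 !addr0.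
rewrite !mxE !l1 /= mul1r mul0r add0r mulN1r rmorphB/=.
rewrite -(mul_conjc_powR (x 0 0) p0) -(mul_conjc_powR (x 1 0) p0).
ring.
Qed.

Lemma numerical_range_circles p b z : 1 < p ->
  numerical_range p (mx2 1 b 0 (-1)) z <->
  exists2 u, 0 <= u <= 1 &
    cmod (z - (2 * u - 1)%:C) = cmod b * wgmean p^-1 u (1 - u).
Proof.
move=> p1; have p0 : 0 < p by rewrite (lt_trans _ p1).
have pK (t : R) : 0 <= t -> (t `^ p) `^ p^-1 = t.
  by move=> t0; rewrite -powRrM divff ?gt_eqF// powRr1.
have pVK (t : R) : 0 <= t -> (t `^ p^-1) `^ p = t.
  by move=> t0; rewrite -powRrM mulVf ?gt_eqF// powRr1.
have cE (t : R) : t - (1 - t) = 2 * t - 1 by ring.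
split=> [[x /= x1 <-]|[u /andP[u0 u1]]].
  have := x1; rewrite lpnorm2_eq1// => xE.
  have vE : cmod (x 1 0) `^ p = 1 - cmod (x 0 0) `^ p by rewrite -xE addrAC subrr add0r.
  exists (cmod (x 0 0) `^ p).
    by rewrite powR_ge0 -subr_ge0 -vE powR_ge0.
  rewrite lpsip_mx2// vE cE addrC addKr.
  rewrite 2!normcM normc_conjc_powR// /wgmean -vE pK ?normc_ge0//.
  by rewrite -mulrA (mulrC (cmod (x 1 0))).
(* The vector (s, t) has norm 1 and off-diagonal term c. That term is linear in x_2, so replacing t
   by e t multiplies it by e and leaves the norm unchanged. *)
set s := u `^ p^-1; set t := (1 - u) `^ p^-1 => zu.
pose c := b * t%:C * (s%:C^* * (cmod s%:C `^ (p - 2))%:C).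
have [e e1 we] : exists2 e, cmod e = 1 & z - (2 * u - 1)%:C = e * c.
  apply: normc_eq_phase; rewrite zu 2!normcM normc_conjc_powR//.
  by rewrite !normc_real ?powR_ge0// pVK// /wgmean -mulrA (mulrC t).
pose x : 'cV[R[i]]_2 := \col_i (if i == 0 then s%:C else e * t%:C).
have x00 : x 0 0 = s%:C by rewrite mxE.
have x10 : x 1 0 = e * t%:C by rewrite mxE.
have xs : cmod (x 0 0) `^ p = u by rewrite x00 normc_real ?powR_ge0// pVK.
have xt : cmod (x 1 0) `^ p = 1 - u.
  rewrite x10 normcM e1 mul1r.
  by rewrite normc_real ?powR_ge0// pVK ?subr_ge0.
have x1 : lpnorm p x = 1 by rewrite lpnorm2_eq1// xs xt addrC subrK.
exists x => //; rewrite lpsip_mx2// xs xt x00 x10 (mulrCA b e) -(mulrA e) -/c -we.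
by rewrite cE subrKC.
Qed.

Lemma circle_of_disc a B u z : 0 < a < 1 -> 0 <= u <= 1 -> 0 <= B ->
  cmod (z - (2 * u - 1)%:C) <= B * wgmean a u (1 - u) ->
  exists2 v, 0 <= v <= 1 &
    cmod (z - (2 * v - 1)%:C) = B * wgmean a v (1 - v).
Proof.
move=> /andP[a0 a1] /andP[u0 u1] B0 zu.
(* For u = 0 or u = 1 the radius is 0, so the disc is already its own circle. *)
have [u_eq0|u_neq0] := eqVneq u 0.
  exists u; rewrite ?u0//; apply/eqP; rewrite eq_le zu.
  by rewrite u_eq0 wgmean0l// mulr0 normc_ge0.
have [u_eq1|u_neq1] := eqVneq u 1.
  exists u; rewrite ?u0//; apply/eqP; rewrite eq_le zu.
  by rewrite u_eq1 subrr wgmean0r// mulr0 normc_ge0.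
have u01 : 0 < u < 1 by rewrite !lt_neqAle u0 u1 u_neq1 eq_sym u_neq0.
have Bg0 v : 0 <= B * wgmean a v (1 - v) by rewrite mulr_ge0 ?wgmean_ge0.
(* The power of the point z with respect to the circle of parameter v: it vanishes exactly on the
   circle, and squaring makes it polynomial in the coordinates of z and the radius. *)
pose h v :=
  (complex.Re z - (2 * v - 1)) ^+ 2 + complex.Im z ^+ 2 - (B * wgmean a v (1 - v)) ^+ 2.
have hE v : h v = cmod (z - (2 * v - 1)%:C) ^+ 2 - (B * wgmean a v (1 - v)) ^+ 2.
  by rewrite normcE_sqr /h; case: z {zu h} => x y /=; rewrite subr0.
have [|||v] := @IVT R h 0 u 0.
- exact: u0.
- have cg := wgmean_within_continuous a1 u01.
  have cq : continuous (fun v : R => complex.Re z - (2 * v - 1)).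
    move=> y; apply: cvgB; first exact: cvg_cst.
    by apply: cvgB; [apply: cvgM; [exact: cvg_cst|exact: cvg_id]|exact: cvg_cst].
  have cw := continuous_subspaceT (A := `[0, u]) cq.
  have cBg : {within `[0, u], continuous (fun v => B * wgmean a v (1 - v))}.
    by move=> x; apply: cvgM (cg x); exact: cvg_cst.
  move=> x; apply: cvgB (cvgM (cBg x) (cBg x)).
  by apply: cvgD (cvgM (cw x) (cw x)) _; exact: cvg_cst.
(* Sign change: h(u) <= 0 since z lies in the disc, and h(0) >= 0 since the radius at 0 is zero. *)
- rewrite ge_min le_max; apply/andP; split; apply/orP; [right|left].
    by rewrite hE subr_le0 ler_sqr ?nnegrE ?normc_ge0.
  by rewrite hE wgmean0l// (mulr0 B) expr0n subr0 sqr_ge0.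
rewrite in_itv/= => /andP[v0 vu] /eqP; rewrite hE subr_eq0 eqrXn2 ?normc_ge0//.
by move=> /eqP; exists v => //; rewrite v0 (le_trans vu).
Qed.

End NumericalRange.

(* Rcomplex R is R[i] viewed as a vector space over R: the convex combinations
   in convex_set have real coefficients. *)
Theorem theorem2p6 (R : realType) (p : R) (b : R[i]) :
  1 < p ->
  convex_set (M := Rcomplex R) (numerical_range p (mx2 1 b 0 (-1))).
Proof.
move=> p1; have p0 : 0 < p by rewrite (lt_trans _ p1).
have a01 : 0 < p^-1 < 1 by rewrite invr_gt0 p0 invf_lt1.
move=> x y t /set_mem/(numerical_range_circles _ _ p1)[u u01 xu].
move=> /set_mem/(numerical_range_circles _ _ p1)[v v01 yv].
apply/mem_set/(numerical_range_circles _ _ p1).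
have t01 : 0 <= t%:num <= 1 by apply/andP; split.
set s := t%:num in t01; have /andP[s0 s1] := t01.
(* The centre 2u - 1 is affine in u, so the centre at w is the same convex combination of the two
   centres. The triangle inequality and concavity of g then put the combined point in the disc at
   w. *)
pose w := s * u + (1 - s) * v.
have w01 : 0 <= w <= 1 by rewrite /w; nra.
apply: (@circle_of_disc _ _ _ w) => //; first exact: normc_ge0.
have -> : conv t x y - (2 * w - 1)%:C =
  s%:C * (x - (2 * u - 1)%:C) + (1 - s)%:C * (y - (2 * v - 1)%:C).
  (* Real scaling in [Rcomplex R] acts on each component, which is multiplication by a real complex
     number. *)
  have -> : conv t x y = s%:C * x + (1 - s)%:C * y :> R[i].
    rewrite [LHS]/(s *: x + (1 - s) *: y).
    by case: x {xu} => x1 x2; case: y {yv} => y1 y2; simpc.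
  by rewrite /w rmorphB/= rmorphD/= !rmorphM/= !rmorphB/= !rmorphM/= rmorph1; ring.
apply: (le_trans (le_normcD _ _)).
rewrite !normcM !normc_real ?subr_ge0// xu yv.
rewrite !(mulrCA _ (cmod b)) -mulrDr ler_wpM2l ?normc_ge0//.
exact: wgmean_concave.
Qed.
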